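(* The interval $[\mathsf{V}(S_7), \mathsf{V}(\mathbf{M}_2(S_7))]$ contains at least countably infinitely many distinct varieties.
   Context: An ai-semiring (additively idempotent semiring) is an algebra $(S,+,\cdot)$ such that $(S,+)$ is a commutative idempotent semigroup, $(S,\cdot)$ is a semigroup, and $x(y+z)=xy+xz$, $(x+y)z=xz+yz$ hold. $S_7=\{1,a,\infty\}$ is the ai-semiring with $x+x=x$ for all $x$ and $x+y=\infty$ for $x\neq y$; its multiplication is commutative with $1\cdot x=x$ for all $x$ and $a\cdot a=a\cdot\infty=\infty\cdot\infty=\infty$. $\mathbf{M}_2(S_7)$ is the ai-semiring of all $2\times 2$ matrices over $S_7$ with entrywise addition and product $(AB)_{ij}=\sum_{k=1}^2 A_{ik}B_{kj}$. A variety of ai-semirings is a class of ai-semirings closed under subalgebras, homomorphic images and arbitrary direct products. $\mathsf{V}(S)$ denotes the smallest variety containing $S$. For varieties $\mathcal{V}_1\subseteq\mathcal{V}_2$, the interval $[\mathcal{V}_1,\mathcal{V}_2]$ is the class of all subvarieties of $\mathcal{V}_2$ that contain $\mathcal{V}_1$. *)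

(* Defs.v *)
From mathcomp Require Import all_boot.
From mathcomp Require Import matrix.
From mathcomp Require Import boolp.

Set Implicit Arguments.
Unset Strict Implicit.
Unset Printing Implicit Defensive.

(* MathComp's semirings carry a zero, which ai-semirings lack, hence a separate
   structure.  Carriers are nonempty, as usual in universal algebra. *)
Record ai_semiring := AISemiring {
  ai_sort :> Type;
  ai_add : ai_sort -> ai_sort -> ai_sort;
  ai_mul : ai_sort -> ai_sort -> ai_sort;
  ai_inhabited : inhabited ai_sort;
  ai_addA : associative ai_add;
  ai_addC : commutative ai_add;
  ai_addxx : idempotent_op ai_add;
  ai_mulA : associative ai_mul;
  ai_mulDr : right_distributive ai_mul ai_add;
  ai_mulDl : left_distributive ai_mul ai_add }.

Declare Scope ai_scope.
Delimit Scope ai_scope with ai.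
Local Open Scope ai_scope.
Notation "x + y" := (ai_add x y) : ai_scope.
Notation "x * y" := (ai_mul x y) : ai_scope.

Definition ai_hom (A B : ai_semiring) (f : A -> B) : Prop :=
  {morph f : x y / x + y} /\ {morph f : x y / x * y}.

Section Product.
Variables (I : Type) (F : I -> ai_semiring).
Let T := forall i, F i.
Let add (x y : T) : T := fun i => x i + y i.
Let mul (x y : T) : T := fun i => x i * y i.

Lemma ai_prod_inhabited : inhabited T.
Proof.
have H i : exists _ : F i, True by have [x] := ai_inhabited (F i); exists x.
exact: inhabits (fun i => projT1 (cid (H i))).
Qed.

Lemma ai_prod_addA : associative add.
Proof. by move=> x y z; apply/functional_extensionality_dep => i; apply: ai_addA. Qed.

Lemma ai_prod_addC : commutative add.
Proof. by move=> x y; apply/functional_extensionality_dep => i; apply: ai_addC. Qed.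

Lemma ai_prod_addxx : idempotent_op add.
Proof. by move=> x; apply/functional_extensionality_dep => i; apply: ai_addxx. Qed.

Lemma ai_prod_mulA : associative mul.
Proof. by move=> x y z; apply/functional_extensionality_dep => i; apply: ai_mulA. Qed.

Lemma ai_prod_mulDr : right_distributive mul add.
Proof. by move=> x y z; apply/functional_extensionality_dep => i; apply: ai_mulDr. Qed.

Lemma ai_prod_mulDl : left_distributive mul add.
Proof. by move=> x y z; apply/functional_extensionality_dep => i; apply: ai_mulDl. Qed.

Definition ai_prod : ai_semiring :=
  AISemiring ai_prod_inhabited ai_prod_addA ai_prod_addC ai_prod_addxx
    ai_prod_mulA ai_prod_mulDr ai_prod_mulDl.
End Product.

(* Classes are plain predicates rather than [set ai_semiring]: the universe
   constraints of [set] would forbid matrices as carriers. *)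
Definition ai_class := ai_semiring -> Prop.

(* A subalgebra of A is given, up to isomorphism, by an injective homomorphism
   into A; being up to isomorphism is harmless, as isomorphic copies are
   homomorphic images. *)
Definition closed_sub (K : ai_class) : Prop :=
  forall (A B : ai_semiring) (f : B -> A),
    ai_hom f -> injective f -> K A -> K B.

Definition closed_image (K : ai_class) : Prop :=
  forall (A B : ai_semiring) (f : A -> B),
    ai_hom f -> (forall y, exists x, f x = y) -> K A -> K B.

Definition closed_prod (K : ai_class) : Prop :=
  forall (I : Type) (F : I -> ai_semiring),
    (forall i, K (F i)) -> K (ai_prod F).

Definition variety (K : ai_class) : Prop :=
  [/\ closed_sub K, closed_image K & closed_prod K].

Definition subclass (K L : ai_class) : Prop := forall A, K A -> L A.

Definition same_class (K L : ai_class) : Prop := forall A, K A <-> L A.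

(* The intersection of all varieties containing S, hence the smallest one. *)
Definition variety_of (S : ai_semiring) : ai_class :=
  fun A => forall K, variety K -> K S -> K A.

Definition variety_interval (V1 V2 : ai_class) (W : ai_class) : Prop :=
  [/\ variety W, subclass V1 W & subclass W V2].

Definition at_least_countably_many (P : ai_class -> Prop) : Prop :=
  exists W : nat -> ai_class,
    (forall n, P (W n)) /\ (forall m n, same_class (W m) (W n) -> m = n).

Inductive S7_elt := S7_one | S7_a | S7_oo.

Definition S7_add (x y : S7_elt) : S7_elt :=
  match x, y with
  | S7_one, S7_one => S7_one
  | S7_a, S7_a => S7_a
  | _, _ => S7_oo
  end.

Definition S7_mul (x y : S7_elt) : S7_elt :=
  match x, y with
  | S7_one, z | z, S7_one => z
  | _, _ => S7_oo
  end.

Lemma S7_addA : associative S7_add. Proof. by do 3!case. Qed.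
Lemma S7_addC : commutative S7_add. Proof. by do 2!case. Qed.
Lemma S7_addxx : idempotent_op S7_add. Proof. by case. Qed.
Lemma S7_mulA : associative S7_mul. Proof. by do 3!case. Qed.
Lemma S7_mulDr : right_distributive S7_mul S7_add. Proof. by do 3!case. Qed.
Lemma S7_mulDl : left_distributive S7_mul S7_add. Proof. by do 3!case. Qed.

Definition S7 : ai_semiring :=
  AISemiring (inhabits S7_one) S7_addA S7_addC S7_addxx S7_mulA S7_mulDr S7_mulDl.

Section Matrix2.
Variable S : ai_semiring.

Definition mat2_add (A B : 'M[S]_2) : 'M[S]_2 :=
  \matrix_(i, j) (A i j + B i j).

(* The sum over k is written out since S has no zero to start a \sum with. *)
Definition mat2_mul (A B : 'M[S]_2) : 'M[S]_2 :=
  \matrix_(i, j) (A i ord0 * B ord0 j + A i ord_max * B ord_max j).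

Lemma ai_addACA : interchange (@ai_add S) (@ai_add S).
Proof.
move=> x y z t; rewrite -!ai_addA; congr (_ + _).
by rewrite !ai_addA (ai_addC y).
Qed.

Lemma mat2_inhabited : inhabited 'M[S]_2.
Proof. by have [x] := ai_inhabited S; exact: inhabits (const_mx x). Qed.

Lemma mat2_addA : associative mat2_add.
Proof. by move=> A B C; apply/matrixP => i j; rewrite !mxE ai_addA. Qed.

Lemma mat2_addC : commutative mat2_add.
Proof. by move=> A B; apply/matrixP => i j; rewrite !mxE ai_addC. Qed.

Lemma mat2_addxx : idempotent_op mat2_add.
Proof. by move=> A; apply/matrixP => i j; rewrite !mxE ai_addxx. Qed.

Lemma mat2_mulA : associative mat2_mul.
Proof.
move=> A B C; apply/matrixP => i j.
by rewrite !mxE !ai_mulDr !ai_mulDl !ai_mulA ai_addACA.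
Qed.

Lemma mat2_mulDr : right_distributive mat2_mul mat2_add.
Proof.
by move=> A B C; apply/matrixP => i j; rewrite !mxE !ai_mulDr ai_addACA.
Qed.

Lemma mat2_mulDl : left_distributive mat2_mul mat2_add.
Proof.
by move=> A B C; apply/matrixP => i j; rewrite !mxE !ai_mulDl ai_addACA.
Qed.

Definition mat2 : ai_semiring :=
  AISemiring mat2_inhabited mat2_addA mat2_addC mat2_addxx
    mat2_mulA mat2_mulDr mat2_mulDl.
End Matrix2.

(* Main.v *)
From mathcomp Require Import all_boot.
From mathcomp Require Import matrix.
From mathcomp Require Import boolp.
Require Import Defs.

(** The identity [x y z_1 ... z_n = y x z_1 ... z_n] holds in the commutative
    semiring [S7], so together with [V(M_2(S7))] it cuts out a variety [W_n] of
    the interval.  To separate [W_m] from [W_n] for [m < n], consider in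
    [M_2(S7) * S7^(n+1)] the pairs [(M, v)] with [v] different from the tuple
    [(1, ..., 1)], and collapse all pairs in which [v] has an infinite
    coordinate.  A product of [n+2] pairs has two factors that are not [1] at
    the same coordinate, so it collapses.  A product of [m+2 <= n+1] pairs whose
    tuples are [a] at pairwise different places does not, and then the matrices
    [C = [1 a; 1 a]], [R = [a a; 1 1]] and [J = [1 1; 1 1]] decide: [C R J ... J]
    is constantly [a], whereas [R C J ... J] has an infinite entry. *)

Set Implicit Arguments.
Unset Strict Implicit.
Unset Printing Implicit Defensive.
Local Open Scope ai_scope.

(** * The swap identities and the varieties they cut out *)

Definition swap_identity (n : nat) : ai_class := fun A =>
  forall (x y : A) (s : seq A), size s = n ->
    foldl (@ai_mul A) (x * y) s = foldl (@ai_mul A) (y * x) s.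

Lemma ai_hom_foldl (A B : ai_semiring) (f : A -> B) (x : A) (s : seq A) :
  ai_hom f -> f (foldl (@ai_mul A) x s) = foldl (@ai_mul B) (f x) (map f s).
Proof. by move=> [_ fM]; elim: s x => //= y s IHs x; rewrite IHs fM. Qed.

Lemma map_surj (A B : Type) (f : A -> B) (s : seq B) :
  (forall y, exists x, f x = y) -> exists s', map f s' = s.
Proof.
move=> fsurj; elim: s => [|y s [s' <-]]; first by exists [::].
by have [x <-] := fsurj y; exists (x :: s').
Qed.

Lemma ai_hom_proj (I : Type) (F : I -> ai_semiring) (i : I) :
  ai_hom (fun x : ai_prod F => x i).
Proof. by []. Qed.

Lemma variety_swap_identity (n : nat) : variety (swap_identity n).
Proof.
split=> [A B f fh finj swA x y s sn|A B f fh fsurj swA x y s|I F swF x y s sn].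
- apply: finj; rewrite !ai_hom_foldl // !(proj2 fh).
  by apply: swA; rewrite size_map.
- have [x' <-] := fsurj x; have [y' <-] := fsurj y.
  have [s' <-] := map_surj s fsurj; rewrite size_map => sn.
  by rewrite -!(proj2 fh) -!ai_hom_foldl // swA.
- apply/functional_extensionality_dep => i.
  rewrite !(ai_hom_foldl _ _ (@ai_hom_proj I F i)).
  by apply: swF; rewrite size_map.
Qed.

Lemma variety_variety_of (S : ai_semiring) : variety (variety_of S).
Proof.
split=> [A B f fh finj KA K Kvar KS|A B f fh fsurj KA K Kvar KS|I F KF K Kvar KS];
  have [Ksub Kim Kprod] := Kvar.
- exact: Ksub fh finj (KA K Kvar KS).
- exact: Kim fh fsurj (KA K Kvar KS).
- by apply: Kprod => i; apply: KF.
Qed.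

Lemma variety_meet (K L : ai_class) :
  variety K -> variety L -> variety (fun A => K A /\ L A).
Proof.
move=> [Ks Ki Kp] [Ls Li Lp].
split=> [A B f fh fi [KA LA]|A B f fh fs [KA LA]|I F KLF].
- by split; [exact: Ks fh fi KA | exact: Ls fh fi LA].
- by split; [exact: Ki fh fs KA | exact: Li fh fs LA].
- by split; [apply: Kp => i | apply: Lp => i]; have [] := KLF i.
Qed.

Lemma S7_mulC : commutative S7_mul.
Proof. by do 2!case. Qed.

Lemma S7_swap_identity (n : nat) : swap_identity n S7.
Proof. by move=> x y s _; congr foldl; apply: S7_mulC. Qed.

(** Constant matrices form a copy of [S]: each entry of a product of two of them is [x * y + x * y],
    which is [x * y] by idempotency. *)
Lemma variety_of_mat2 (S : ai_semiring) : variety_of (mat2 S) S.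
Proof.
move=> K [Ksub _ _]; apply: (Ksub _ _ (fun x : S => const_mx x : mat2 S)).
  by split=> x y; apply/matrixP => i j; rewrite !mxE // ai_addxx.
by move=> x y /matrixP/(_ ord0 ord0); rewrite !mxE.
Qed.

Definition swap_variety (n : nat) : ai_class := fun A =>
  variety_of (mat2 S7) A /\ swap_identity n A.

Lemma swap_variety_interval (n : nat) :
  variety_interval (variety_of S7) (variety_of (mat2 S7)) (swap_variety n).
Proof.
have Wvar : variety (swap_variety n).
  exact: variety_meet (variety_variety_of _) (variety_swap_identity n).
split=> // A; last by case.
apply=> //; split; [exact: variety_of_mat2 | exact: S7_swap_identity].
Qed.

(** * Subalgebras carried by closed predicates *)

Section Subalgebra.
Variables (A : ai_semiring) (P : A -> Prop).
Hypothesis P_inhabited : exists x, P x.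
Hypothesis P_add : forall x y, P x -> P y -> P (x + y).
Hypothesis P_mul : forall x y, P x -> P y -> P (x * y).

Let T := {x : A | P x}.
Let add (x y : T) : T := exist _ _ (P_add (svalP x) (svalP y)).
Let mul (x y : T) : T := exist _ _ (P_mul (svalP x) (svalP y)).

Let sval_inj : injective (sval : T -> A).
Proof. by move=> [x Px] [y Py] /= xy; apply: eq_exist. Qed.

Let inhabitedT : inhabited T.
Proof. by have [x Px] := P_inhabited; exact: inhabits (exist _ x Px). Qed.

Let addA : associative add.
Proof. by move=> x y z; apply: sval_inj; apply: ai_addA. Qed.

Let addC : commutative add.
Proof. by move=> x y; apply: sval_inj; apply: ai_addC. Qed.

Let addxx : idempotent_op add.
Proof. by move=> x; apply: sval_inj; apply: ai_addxx. Qed.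

Let mulA : associative mul.
Proof. by move=> x y z; apply: sval_inj; apply: ai_mulA. Qed.

Let mulDr : right_distributive mul add.
Proof. by move=> x y z; apply: sval_inj; apply: ai_mulDr. Qed.

Let mulDl : left_distributive mul add.
Proof. by move=> x y z; apply: sval_inj; apply: ai_mulDl. Qed.

Lemma subalgebra_exists :
  exists (B : ai_semiring) (f : B -> A),
    [/\ ai_hom f, injective f & forall x, P x <-> exists y, f y = x].
Proof.
exists (AISemiring inhabitedT addA addC addxx mulA mulDr mulDl), sval.
split=> [//|//|x]; split=> [Px | [y <-]]; first by exists (exist _ x Px).
exact: svalP.
Qed.
End Subalgebra.

(** * Collapsing an absorbing set to a point *)

Section ReesQuotient.
Variables (A : ai_semiring) (I : A -> Prop) (z : A).
Hypothesis Iz : I z.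
Hypothesis I_add : forall x y, I x -> I (x + y).
Hypothesis I_mull : forall x y, I y -> I (x * y).
Hypothesis I_mulr : forall x y, I x -> I (x * y).

(** The quotient is carried by representatives: [z] stands for all of [I], any other element for
    itself. *)
Let rep (x : A) : A := if pselect (I x) then z else x.
Let T := {x : A | I x -> x = z}.

Let rep_subproof (x : A) : I (rep x) -> rep x = z.
Proof. by rewrite /rep; case: pselect. Qed.

Let pr (x : A) : T := exist _ (rep x) (@rep_subproof x).

Let pr_eq (x y : A) : pr x = pr y <-> x = y \/ I x /\ I y.
Proof.
split=> [[]|xy].
  rewrite /rep; case: pselect => Ix; case: pselect => Iy /=; try by [left|right].
  - by move=> zy; case: Iy; rewrite -zy.
  - by move=> xz; case: Ix; rewrite xz.
suff: rep x = rep y by exact: eq_exist.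
case: xy => [->|[Ix Iy]] //.
by rewrite /rep; case: pselect => //= _; case: pselect.
Qed.

Let prK (t : T) : pr (sval t) = t.
Proof.
case: t => x xz; apply: eq_exist; rewrite /= /rep.
by case: pselect => //= Ix; rewrite xz.
Qed.

(** Passing to the representative changes nothing outside [I], and inside [I] absorption makes any
    change harmless; hence [pr] respects both operations. *)
Let rep_or (x : A) : sval (pr x) = x \/ I (sval (pr x)) /\ I x.
Proof. exact/pr_eq/prK. Qed.

Let add (t u : T) : T := pr (sval t + sval u).
Let mul (t u : T) : T := pr (sval t * sval u).

Let I_addr (x y : A) : I y -> I (x + y).
Proof. by rewrite ai_addC; apply: I_add. Qed.

Let prD (x y : A) : pr (x + y) = add (pr x) (pr y).
Proof.
apply/esym/pr_eq; case: (rep_or x) => [->|[Ix' Ix]]; last first.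
  by right; split; apply: I_add.
case: (rep_or y) => [->|[Iy' Iy]]; first by left.
by right; split; apply: I_addr.
Qed.

Let prM (x y : A) : pr (x * y) = mul (pr x) (pr y).
Proof.
apply/esym/pr_eq; case: (rep_or x) => [->|[Ix' Ix]]; last first.
  by right; split; apply: I_mulr.
case: (rep_or y) => [->|[Iy' Iy]]; first by left.
by right; split; apply: I_mull.
Qed.

Let addA : associative add.
Proof.
(* Once every element is written as a value of [pr], the law is the image of the same law in [A]. *)
by move=> x y w; rewrite -[x]prK -[y]prK -[w]prK -!prD ai_addA.
Qed.

Let addC : commutative add.
Proof. by move=> x y; rewrite -[x]prK -[y]prK -!prD ai_addC. Qed.

Let addxx : idempotent_op add.
Proof. by move=> x; rewrite -[x]prK -!prD ai_addxx. Qed.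

Let mulA : associative mul.
Proof.
by move=> x y w; rewrite -[x]prK -[y]prK -[w]prK -!prM ai_mulA.
Qed.

Let mulDr : right_distributive mul add.
Proof.
by move=> x y w; rewrite -[x]prK -[y]prK -[w]prK -prD -!prM -prD ai_mulDr.
Qed.

Let mulDl : left_distributive mul add.
Proof.
by move=> x y w; rewrite -[x]prK -[y]prK -[w]prK -prD -!prM -prD ai_mulDl.
Qed.

Lemma rees_quotient_exists :
  exists (Q : ai_semiring) (f : A -> Q),
    [/\ ai_hom f, forall q, exists x, f x = q
      & forall x y, f x = f y <-> x = y \/ I x /\ I y].
Proof.
exists (AISemiring (inhabits (pr z)) addA addC addxx mulA mulDr mulDl), pr.
split=> [|q|]; [by split; [exact: prD | exact: prM] | | exact: pr_eq].
by exists (sval q); apply: prK.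
Qed.
End ReesQuotient.

(** * The semiring separating two swap identities *)

Section Witness.
Variable n : nat.

(** [None] indexes the matrix factor and [Some i] the [n+1] copies of [S7], so that a single
    [ai_prod] suffices. *)
Let factor (o : option 'I_n.+1) : ai_semiring :=
  if o is Some _ then S7 else mat2 S7.
Let prod := ai_prod factor.

Let pair (M : mat2 S7) (v : 'I_n.+1 -> S7) : prod :=
  fun o => match o return factor o with None => M | Some i => v i end.

Let mat (x : prod) : mat2 S7 := x None.
Let coord (x : prod) (i : 'I_n.+1) : S7 := x (Some i).

Let nonunit (x : prod) := exists i, coord x i <> S7_one.
Let infinite (x : prod) := exists i, coord x i = S7_oo.

(** In [S7] a sum or a product is [S7_one] only if both arguments are. *)
Let nonunit_add (x y : prod) : nonunit x -> nonunit y -> nonunit (x + y).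
Proof.
move=> [i xi] _; exists i; move: xi; rewrite /coord /=.
by case: (x _) (y _) => -[].
Qed.

Let nonunit_mul (x y : prod) : nonunit x -> nonunit y -> nonunit (x * y).
Proof.
move=> [i xi] _; exists i; move: xi; rewrite /coord /=.
by case: (x _) (y _) => -[].
Qed.

Let infinite_add (x y : prod) : infinite x -> infinite (x + y).
Proof. by move=> [i xi]; exists i; move: xi; rewrite /coord /= => ->. Qed.

Let infinite_mulr (x y : prod) : infinite x -> infinite (x * y).
Proof. by move=> [i xi]; exists i; move: xi; rewrite /coord /= => ->; case: (y _). Qed.

Let infinite_mull (x y : prod) : infinite y -> infinite (x * y).
Proof. by move=> [i xi]; exists i; move: xi; rewrite /coord /= => ->; case: (x _). Qed.

Let support (x : prod) : {set 'I_n.+1} := [set i | `[< coord x i <> S7_one >]].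

(** Each further factor is not [1] at some coordinate. If the product so far is not [1] there
    either, the new product is infinite; otherwise the support gains that coordinate. *)
Let infinite_or_card (T : Type) (f : T -> prod) (x : T) (s : seq T) :
  (forall t, nonunit (f t)) ->
  let p := foldl (@ai_mul prod) (f x) (map f s) in
  infinite p \/ (size s < #|support p|)%N.
Proof.
move=> nu_f; elim/last_ind: s => [|s y IHs] /=.
  right; have [i xi] := nu_f x.
  by rewrite card_gt0; apply/set0Pn; exists i; rewrite inE; apply/asboolP.
rewrite map_rcons foldl_rcons size_rcons.
set w := foldl _ _ _ in IHs *.
have [winf|lt_sw] := IHs; first by left; apply: infinite_mulr.
have [inf|fin] := EM (infinite (w * f y)); [by left | right].
apply: leq_ltn_trans lt_sw (proper_card _); have [i yi] := nu_f y.
apply/properP; split; last exists i.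
- apply/subsetP => j; rewrite !inE => /asboolP wj; apply/asboolP.
  by move: wj; rewrite /coord /=; case: (w _) (f y _) => -[].
- rewrite inE; apply/asboolP; move: yi; rewrite /coord /=.
  by case: (w _) (f y _) => -[].
- rewrite inE; apply/asboolP => wi; apply: fin; exists i; move: wi yi.
  by rewrite /coord /=; case: (w _) (f y _) => -[].
Qed.

(** The index [k] is a bare natural number; for [k > n] the tuple is constantly [1]. *)
Let a_at (k : nat) (i : 'I_n.+1) : S7 :=
  if i == k :> nat then S7_a else S7_one.

Let J : mat2 S7 := const_mx S7_one.
Let C : mat2 S7 := (\matrix_(i, j) if j == ord_max then S7_a else S7_one)%R.
Let R : mat2 S7 := (\matrix_(i, j) if i == ord_max then S7_one else S7_a)%R.

Let z (k : nat) : prod := pair J (a_at k.+2).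

(** Every entry of [C R] is [1 * a + a * 1 = a], and multiplying by [J] on the right gives
    [a + a = a] again. *)
Let mat_CR (m : nat) :
  mat (foldl (@ai_mul prod) (pair C (a_at 0) * pair R (a_at 1)) (mkseq z m))
  = const_mx S7_a.
Proof.
elim: m => [|m IHm].
  by apply/matrixP => i j; rewrite !mxE.
rewrite mkseqS foldl_rcons; set w := foldl _ _ _ in IHm *.
rewrite /mat /= -/(mat w) IHm.
by apply/matrixP => i j; rewrite !mxE.
Qed.

(** The top right entry of [R C] is [a * a + a * a], which is infinite; right multiplication by [J]
    sums each row, so it stays infinite. *)
Let mat_RC (m : nat) :
  mat (foldl (@ai_mul prod) (pair R (a_at 1) * pair C (a_at 0)) (mkseq z m))
    ord0 ord_max = S7_oo.
Proof.
elim: m => [|m IHm].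
  by rewrite /mat /= !mxE /=.
rewrite mkseqS foldl_rcons; set w := foldl _ _ _ in IHm *.
by rewrite /mat /= mxE !mxE -/(mat w) IHm /=; case: (mat w _ _).
Qed.

(** The factors carry their [a] at the distinct places [0, ..., m+1], so [a * a] never occurs. *)
Let coord_prefix (m : nat) (i : 'I_n.+1) :
  coord (foldl (@ai_mul prod) (pair C (a_at 0) * pair R (a_at 1)) (mkseq z m)) i
  = if (i < m.+2)%N then S7_a else S7_one.
Proof.
elim: m => [|m IHm].
  by rewrite /coord /= /a_at; case: i => -[|[|]].
rewrite mkseqS foldl_rcons; set w := foldl _ _ _ in IHm *.
rewrite /coord /= -/(coord w i) IHm /a_at (ltnS i m.+2) (leq_eqVlt i m.+2).
by case: ltngtP.
Qed.

Lemma swap_identity_witness :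
  exists Q : ai_semiring,
    [/\ variety_of (mat2 S7) Q, swap_identity n Q
      & forall m, (m < n)%N -> ~ swap_identity m Q].
Proof.
have nu_pair M k : (k < n.+1)%N -> nonunit (pair M (a_at k)).
  by move=> lt_kn; exists (Ordinal lt_kn); rewrite /coord /= /a_at eqxx.
have [|B [e [eh einj eP]]] := subalgebra_exists _ nonunit_add nonunit_mul.
  by exists (pair J (a_at 0)); apply: nu_pair.
have nu_e b : nonunit (e b) by apply/eP; exists b.
(* An infinite element of the subalgebra is needed as the point to which the infinite ones
   collapse. *)
have nu_oo : nonunit (pair J (fun=> S7_oo)) by exists ord0.
have [b0 eb0] := (eP _).1 nu_oo.
have [|x y|x y|x y|Q [f [fh fsurj fP]]] :=
    @rees_quotient_exists B (fun b => infinite (e b)) b0.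
- by rewrite eb0; exists ord0.
- by rewrite (proj1 eh); apply: infinite_add.
- by rewrite (proj2 eh); apply: infinite_mull.
- by rewrite (proj2 eh); apply: infinite_mulr.
exists Q; split.
- have [Vsub Vim Vprod] := variety_variety_of (mat2 S7).
  apply: Vim fh fsurj _; apply: Vsub eh einj _; apply: Vprod => -[i|] //=.
  exact: variety_of_mat2.
- have inf_foldl b c (s : seq B) :
    size s = n -> infinite (e (foldl (@ai_mul B) (b * c) s)).
    move=> sn; rewrite ai_hom_foldl // (proj2 eh).
    (* A finite product of these [n+2] factors would have more than [n+1] coordinates in its
       support. *)
    have [//|] := infinite_or_card b (c :: s) nu_e.
    by rewrite /= sn ltnNge -[X in (_ <= X)%N]card_ord max_card.
  move=> x y s; have [b <-] := fsurj x; have [c <-] := fsurj y.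
  have [t <-] := map_surj s fsurj; rewrite size_map => tn.
  rewrite -!(proj2 fh) -!ai_hom_foldl //; apply/fP; right.
  by split; apply: inf_foldl.
- move=> m lt_mn swQ.
  (* The places used go up to [m+1], which is at most [n] because [m < n]. *)
  have lift M k : (k < n.+1)%N -> exists b, e b = pair M (a_at k).
    by move=> lt_kn; apply/eP/nu_pair.
  have [b eb] := lift C 0 isT.
  have [c ec] := lift R 1%N (leq_ltn_trans (leq0n m) lt_mn).
  have [t et] : exists t, map e t = mkseq z m.
    elim: m lt_mn {swQ} => [|m IHm] lt_mn; first by exists [::].
    have [t et] := IHm (ltnW lt_mn); have [d ed] := lift J m.+2 lt_mn.
    by exists (rcons t d); rewrite map_rcons mkseqS et ed.
  have tm : size t = m by rewrite -(size_map e) et size_mkseq.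
  have := swQ (f b) (f c) (map f t); rewrite size_map => /(_ tm).
  (* Either the two products agree in [B], against their top right matrix entries, or both collapse,
     against the finite coordinates of the first. *)
  rewrite -!(proj2 fh) -!ai_hom_foldl // => /fP; case.
    move=> bc; have := mat_RC m.
    rewrite -et -eb -ec -(proj2 eh) -ai_hom_foldl // -bc.
    by rewrite ai_hom_foldl // (proj2 eh) eb ec et mat_CR mxE.
  case=> -[i] + _; rewrite ai_hom_foldl // (proj2 eh) eb ec et.
  by rewrite coord_prefix; case: ifP.
Qed.
End Witness.

(** * Pairwise distinctness of the varieties [W_n] *)

Theorem proposition4p3 :
  at_least_countably_many
    (variety_interval (variety_of S7) (variety_of (mat2 S7))).
Proof.
exists swap_variety; split=> [n|m n Wmn]; first exact: swap_variety_interval.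
have noW k l : (k < l)%N -> ~ same_class (swap_variety k) (swap_variety l).
  move=> lt_kl Wkl; have [Q [VQ swQ nswQ]] := swap_identity_witness l.
  by have [_ /(nswQ k lt_kl)] := (Wkl Q).2 (conj VQ swQ).
case: (ltngtP m n) => // [lt_mn|lt_nm]; first by case: (noW _ _ lt_mn).
by case: (noW _ _ lt_nm) => A; split=> /Wmn.
Qed.
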